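(* Consider the SPDE on the separable Hilbert space $H$ $$dr_t = (A r_t + \alpha(r_t))\,dt + \sigma(r_{t-})\,dX_t,\qquad r_0 = h_0,$$ where $A$, $\alpha$, $\sigma$ and $X$ satisfy the standing assumptions in the context. Let $V \subset H$ be a finite dimensional subspace such that: 1. $V$ is $A$-invariant. 2. $\alpha(H) \subset V$. 3. $\sigma^k(H) \subset V$ for all $k=1,\ldots,m$. Then the SPDE has an affine realization generated by $V$.
   Context: Standing assumptions. $(\Omega,\mathcal{F},(\mathcal{F}_t)_{t \ge 0},\mathbb{P})$ is a filtered probability space satisfying the usual conditions; $X$ is an $\mathbb{R}^m$-valued Lévy process ($m \in \mathbb{N}$) whose components $X^1,\ldots,X^m$ are nontrivial square-integrable martingales; $H$ is a (real) separable Hilbert space; $A : \mathcal{D}(A) \subset H \to H$ is the generator of a $C_0$-semigroup $(S_t)_{t\ge 0}$ on $H$ which is pseudo-contractive, i.e. $\|S_t\| \le e^{\omega t}$ for all $t \ge 0$, for some $\omega \in \mathbb{R}$; $\alpha : H \to H$ and $\sigma=(\sigma^1,\ldots,\sigma^m) : H \to H^m$ are Lipschitz continuous. Weak solution. For $h_0 \in H$ the weak solution of the SPDE is the $H$-valued càdlàg adapted process $r$ (unique up to indistinguishability; it exists because $A$ generates a pseudo-contractive $C_0$-semigroup, $\alpha$ and $\sigma$ are Lipschitz continuous, and the components of the Lévy process $X$ are square-integrable martingales) such that for each $\xi \in \mathcal{D}(A^* )$ $$\langle \xi,r_t\rangle = \langle \xi,h_0\rangle + \int_0^t \big(\langle A^*\xi,r_s\rangle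 + \langle \xi,\alpha(r_s)\rangle\big)ds + \sum_{k=1}^m \int_0^t \langle \xi,\sigma^k(r_{s-})\rangle dX^k_s,\quad t \ge 0.$$ Subspaces. $V$ is $A$-invariant if $V \subset \mathcal{D}(A)$ and $A(V) \subset V$. Foliations and affine realizations. A family $(\mathcal{M}_t)_{t \ge 0}$ of subsets of $H$ is a ($C^0$-)foliation generated by $V$ if there is a continuous map $\psi : \mathbb{R}_+ \to H$ with $\mathcal{M}_t = \psi(t) + V$ for all $t \ge 0$. It is invariant for the SPDE if for all $t_0 \ge 0$ and $h_0 \in \mathcal{M}_{t_0}$ the weak solution $r$ with $r_0=h_0$ satisfies, outside a $\mathbb{P}$-nullset, $r_t \in \mathcal{M}_{t_0+t}$ for all $t \ge 0$. The SPDE has an affine realization generated by $V$ if for every $h_0 \in H$ there is an invariant foliation $(\mathcal{M}_t)_{t \ge 0}$ generated by $V$ with $h_0 \in \mathcal{M}_0$. *)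

(* Defs.v *)
From HB Require Import structures.
From mathcomp Require Import all_boot all_order all_algebra sesquilinear.
From mathcomp Require Import all_classical all_reals all_analysis.

Set Implicit Arguments.
Unset Strict Implicit.
Unset Printing Implicit Defensive.

Import Order.TTheory GRing.Theory Num.Theory.
Import numFieldNormedType.Exports.

Local Open Scope classical_set_scope.
Local Open Scope ring_scope.

(* Time is the half-line [0, +oo[ of R. Families indexed by time are functions
   on all of R whose values at negative times are never used. *)

Section hilbert.
Context (R : realType) (H : completeNormedModType R).

(* A real Hilbert space is a complete normed space whose norm comes from an
   inner product. *)
Definition norm_from_dot (ip : {dot H for @idfun R}) : Prop :=
  forall x : H, `|x| ^+ 2 = ip x x.

Definition separable_space : Prop :=
  exists D : set H, countable D /\ dense D.

Definition fin_dim_subspace (V : set H) : Prop :=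
  exists (n : nat) (e : 'I_n -> H),
    V = range (fun c : 'I_n -> R => \sum_(i < n) c i *: e i).

Definition c0_semigroup (S : R -> H -> H) : Prop :=
  [/\ forall t : R, 0 <= t -> linear (S t) /\ continuous (S t),
      forall x, S 0 x = x,
      forall (s t : R) x, 0 <= s -> 0 <= t -> S (s + t) x = S s (S t x)
    & forall x, S t x @[t --> 0^'+] --> x].

Definition pseudo_contractive (S : R -> H -> H) : Prop :=
  exists omega : R, forall (t : R) x, 0 <= t -> `|S t x| <= expR (omega * t) * `|x|.

(* An unbounded operator is a pair of a domain DA and a total function A whose
   values outside DA are irrelevant. *)
Definition generator (S : R -> H -> H) (DA : set H) (A : H -> H) : Prop :=
  (forall x, DA x <-> cvg (t^-1 *: (S t x - x) @[t --> 0^'+])) /\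
  (forall x, DA x -> t^-1 *: (S t x - x) @[t --> 0^'+] --> A x).

(* xi is in the domain of the adjoint of A, which maps xi to eta. When DA is
   dense, xi determines eta. *)
Definition adjoint_graph (ip : {dot H for @idfun R}) (DA : set H) (A : H -> H)
    (xi eta : H) : Prop :=
  forall x, DA x -> ip xi (A x) = ip eta x.

(* Lipschitz continuity of (sigma^1, ..., sigma^m) : H -> H^m, where H^m
   carries the norm of the direct sum of Hilbert spaces. *)
Definition lipschitz_pow (m : nat) (sigma : 'I_m -> H -> H) : Prop :=
  exists L : R, forall x y,
    Num.sqrt (\sum_(k < m) `|sigma k x - sigma k y| ^+ 2) <= L * `|x - y|.

Definition operator_invariant (DA : set H) (A : H -> H) (V : set H) : Prop :=
  V `<=` DA /\ A @` V `<=` V.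

Definition foliation (V : set H) (M : R -> set H) : Prop :=
  exists psi : R -> H, {within `[0, +oo[, continuous psi} /\
    forall t : R, 0 <= t -> M t = [set psi t + v | v in V].

End hilbert.

Section processes.
Context d (T : measurableType d) (R : realType) (P : probability T R).
Variable F : R -> set_system T.

Definition filtration : Prop :=
  [/\ forall t : R, 0 <= t -> sigma_algebra setT (F t),
      forall t : R, 0 <= t -> F t `<=` measurable
    & forall s t : R, 0 <= s -> s <= t -> F s `<=` F t].

Definition usual_conditions : Prop :=
  [/\ measure_is_complete P, P.-negligible `<=` F 0
    & forall t : R, 0 <= t -> F t = \bigcap_(s in [set s | t < s]) F s].

Definition adapted (E : topologicalType) (Y : R -> T -> E) : Prop :=
  forall t : R, 0 <= t -> forall U : set E, <<s open >> U -> F t (Y t @^-1` U).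

Definition cadlag (E : ptopologicalType) (Y : R -> T -> E) : Prop :=
  forall w (t : R), 0 <= t ->
    (Y s w @[s --> t^'+] --> Y t w) /\ (0 < t -> cvg (Y s w @[s --> t^'-])).

Definition left_lim (E : ptopologicalType) (Y : R -> T -> E) (t : R) (w : T) : E :=
  lim (Y s w @[s --> t^'-]).

(* The identity tested on the events B of F s says that M s is the conditional
   expectation of M t given F s. *)
Definition martingale (M : R -> T -> R) : Prop :=
  [/\ adapted M,
      forall t : R, 0 <= t -> P.-integrable setT (EFin \o M t)
    & forall s t : R, 0 <= s -> s <= t -> forall B, F s B ->
        (\int[P]_(w in B) (M t w)%:E = \int[P]_(w in B) (M s w)%:E)%E].

Definition square_integrable (M : R -> T -> R) : Prop :=
  forall t : R, 0 <= t -> P.-integrable setT (fun w => (M t w ^+ 2)%:E).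

Definition nontrivial_process (M : R -> T -> R) : Prop :=
  ~ (forall t : R, 0 <= t -> {ae P, forall w, M t w = 0}).

Definition increment (m : nat) (X : 'I_m -> R -> T -> R) (s t : R) (w : T) :
    m.-tuple R :=
  [tuple X k t w - X k s w | k < m].

(* Levy process relative to the filtration F; stochastic continuity follows
   from cadlag paths and stationary increments. *)
Definition levy_process (m : nat) (X : 'I_m -> R -> T -> R) : Prop :=
  [/\ forall k, cadlag (X k) /\ adapted (X k),
      forall k, {ae P, forall w, X k 0 w = 0},
      forall s t : R, 0 <= s -> s <= t ->
        forall B (E : set (m.-tuple R)), F s B -> measurable E ->
        (P (B `&` increment X s t @^-1` E) =
         P B * P (increment X s t @^-1` E))%E
    & forall s t : R, 0 <= s -> s <= t ->
        forall E : set (m.-tuple R), measurable E ->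
        P (increment X s t @^-1` E) = P (increment X 0 (t - s) @^-1` E)].

Definition stopping_time (tau : T -> R) : Prop :=
  forall t : R, 0 <= t -> F t [set w | tau w <= t].

Definition stopped_sigma_algebra (tau : T -> R) : set_system T :=
  [set B | measurable B /\
    forall t : R, 0 <= t -> F t (B `&` [set w | tau w <= t])].

(* The process sum_(i < n) val_i 1_{]tau_i, tau_(i+1)]}, with stopping times
   0 <= tau_0 <= ... <= tau_n and val_i measurable for the sigma-algebra of
   events before tau_i. *)
Record simple_predictable := SimplePredictable {
  sp_size : nat;
  sp_time : nat -> T -> R;
  sp_val : nat -> T -> R;
  sp_stopping : forall i, stopping_time (sp_time i);
  sp_time_ge0 : forall i w, 0 <= sp_time i w;
  sp_time_le : forall i w, sp_time i w <= sp_time i.+1 w;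
  sp_val_measurable : forall i (U : set R), measurable U ->
    stopped_sigma_algebra (sp_time i) (sp_val i @^-1` U) }.

Definition sp_process (Z : simple_predictable) (s : R) (w : T) : R :=
  \sum_(i < sp_size Z)
    sp_val Z i w * (sp_time Z i w < s <= sp_time Z i.+1 w)%R%:R.

Definition sp_integral (Z : simple_predictable) (M : R -> T -> R)
    (t : R) (w : T) : R :=
  \sum_(i < sp_size Z) sp_val Z i w *
    (M (Num.min t (sp_time Z i.+1 w)) w - M (Num.min t (sp_time Z i w)) w).

(* Convergence uniformly on compacts in probability. Time 0 is left out, since
   integrals run over ]0, t]. The event is { sup_(0 < s <= t) |..| > eps },
   which is measurable for processes with one-sided limits and left- or
   right-continuous paths. *)
Definition ucp_cvg (U : nat -> R -> T -> R) (Y : R -> T -> R) : Prop :=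
  forall t eps : R, 0 <= t -> 0 < eps ->
    P [set w | exists s : R, 0 < s <= t /\ eps < `|U n s w - Y s w|]
      @[n --> \oo] --> 0%E.

(* I is the stochastic integral of the caglad adapted process Y against the
   semimartingale M, in the sense of Protter (Stochastic Integration and
   Differential Equations, II.4): integration against M is the extension, ucp
   to ucp continuous, of the elementary integral from the simple predictable
   processes to the caglad adapted ones, among which the former are dense. *)
Definition stochastic_integral (M Y I : R -> T -> R) : Prop :=
  [/\ cadlag I, adapted I
    & forall Z : nat -> simple_predictable,
        ucp_cvg (fun n => sp_process (Z n)) Y ->
        ucp_cvg (fun n => sp_integral (Z n) M) I].

Section spde.
Context (H : completeNormedModType R) (ip : {dot H for @idfun R}).
Context (m : nat) (X : 'I_m -> R -> T -> R).
Variables (DA : set H) (A alpha : H -> H) (sigma : 'I_m -> H -> H).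

Definition weak_solution (h0 : H) (r : R -> T -> H) : Prop :=
  [/\ cadlag r, adapted r
    & forall xi Axi, adjoint_graph ip DA A xi Axi ->
      exists J : 'I_m -> R -> T -> R,
        (forall k, stochastic_integral (X k)
           (fun s w => ip xi (sigma k (left_lim r s w))) (J k)) /\
        {ae P, forall w, forall t : R, 0 <= t ->
           ip xi (r t w) = ip xi h0
             + \int[lebesgue_measure]_(s in `[0, t])
                 (ip Axi (r s w) + ip xi (alpha (r s w)))
             + \sum_(k < m) J k t w}].

(* The weak solution started at h0 is unique up to indistinguishability, and
   the property below is unaffected by changing it on a null set; it is
   therefore required of each of its versions. *)
Definition invariant_foliation (M : R -> set H) : Prop :=
  forall (t0 : R) h0, 0 <= t0 -> M t0 h0 ->
    forall r, weak_solution h0 r ->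
      {ae P, forall w, forall t : R, 0 <= t -> M (t0 + t) (r t w)}.

Definition affine_realization (V : set H) : Prop :=
  forall h0, exists M : R -> set H,
    [/\ foliation V M, invariant_foliation M & M 0 h0].

End spde.
End processes.

(* Main.v *)
(** The foliation through h0 is M_t = S_t h0 + V. Let r be a weak solution
    started at h and let z be orthogonal to V. Since V is A-invariant and finite
    dimensional, it is S-invariant, so xi = \int_0^u S_s^* z ds is orthogonal to
    V; it lies in the domain of A^*, with A^* xi = S_u^* z - z. Testing the weak
    formulation with xi removes alpha and sigma, hence the noise, and leaves
      \int_0^u <z, S_s (r_t - h)> ds = \int_0^t <z, S_u r_s - r_s> ds.
    This is required for countably many z and for rational u only, so it holds
    simultaneously outside one null set; it is then extended to real u pathwise.
    It is the integrated form of a transport equation in (u, t), whose solution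
    along the characteristics u + t = const gives <z, r_t> = <z, S_t h>. *)

Require Import Defs.
From HB Require Import structures.
From mathcomp Require Import all_boot all_order all_algebra sesquilinear.
From mathcomp Require Import all_classical all_reals all_analysis.
From mathcomp Require Import measurable_realfun ring lra.

Set Implicit Arguments.
Unset Strict Implicit.
Unset Printing Implicit Defensive.

Import Order.TTheory GRing.Theory Num.Theory.
Import numFieldNormedType.Exports.

Local Open Scope classical_set_scope.
Local Open Scope ring_scope.

Local Notation I f a b := (\int[lebesgue_measure]_(s in `[a, b]) f s).

(** * Paths with left limits *)

Section paths.
Context {R : realType}.
Implicit Types (a b p s t T : R).

(* By real induction: the supremum of the t with Q 0 t is T. *)
Lemma interval_induction (Q : R -> R -> Prop) T : 0 <= T ->
  (forall a b c, a <= b -> b <= c -> Q a b -> Q b c -> Q a c) ->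
  (forall p, 0 <= p <= T -> exists2 d, 0 < d &
     (forall b, p <= b -> b < p + d -> b <= T -> Q p b) /\
     (forall a, 0 <= a -> p - d < a -> a <= p -> Q a p)) ->
  Q 0 T.
Proof.
move=> T0 Qtrans Qloc.
pose E := [set t | 0 <= t <= T /\ Q 0 t].
have E0 : E 0.
  split; first by rewrite lexx.
  have [|d d0 [Qr _]] := Qloc 0; first by rewrite lexx.
  by apply: Qr; rewrite ?add0r.
have supE : has_sup E.
  by split; [exists 0 | exists T => t [/andP[]]].
have p0 : 0 <= sup E by apply: ub_le_sup => //; case: supE.
have pT : sup E <= T.
  by apply: ge_sup; [exists 0 | move=> t [/andP[]]].
have [|d d0 [Qr Ql]] := Qloc (sup E); first by rewrite p0.
have [a [/andP[a0 aT] Qa] pa] := sup_adherent d0 supE.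
have ap : a <= sup E by apply: ub_le_sup; [case: supE | split; rewrite ?a0].
have Qp : Q 0 (sup E) by apply: (Qtrans _ a) => //; exact: Ql.
have [pltT|] := ltP (sup E) T; last first.
  by move=> Tp; suff -> : T = sup E by []; apply/eqP; rewrite eq_le Tp.
pose b := Num.min T (sup E + d / 2).
have pb : sup E < b by rewrite lt_min pltT ltrDl divr_gt0.
have bT : b <= T by rewrite ge_min lexx.
have bd : b < sup E + d.
  by rewrite gt_min ltrD2l ltr_pdivrMr// ltr_pMr// ltr1n orbT.
have : E b.
  split; first by rewrite bT (le_trans p0 (ltW pb)).
  by apply: (Qtrans _ (sup E)) => //; [exact: ltW | apply: Qr => //; exact: ltW].
move=> /(ub_le_sup (proj2 supE)); by rewrite leNgt pb.
Qed.

(* Values at negative times are unconstrained. *)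
Definition rcll (W : normedModType R) (c : R -> W) :=
  forall t, 0 <= t -> exists l, forall e, 0 < e -> exists2 d, 0 < d &
    (forall s, t <= s -> s < t + d -> `|c s - c t| <= e) /\
    (forall s, 0 <= s -> t - d < s -> s < t -> `|c s - l| <= e).

(** A bounded linear map is Lipschitz, so it carries one-sided limits to one-sided limits. The
    constant is enlarged to |K| + 1, which is positive for every [K]. *)
Lemma rcll_linear (W W' : normedModType R) (c : R -> W) (f : W -> W') K :
  linear f -> (forall x, `|f x| <= K * `|x|) -> rcll c ->
  rcll (fun s => f (c s)).
Proof.
move=> lf bf rc t t0; have [l cl] := rc t t0.
pose fL := GRing.isLinear.Build _ _ _ _ f lf.
pose F : {linear W -> W'} := HB.pack f fL.
have fB x y : `|f x - f y| <= (`|K| + 1) * `|x - y|.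
  rewrite (_ : f x - f y = f (x - y)); last exact/esym/(raddfB F).
  rewrite (le_trans (bf _))// ler_wpM2r// (le_trans (ler_norm _))//.
  by rewrite lerDl.
have K0 : 0 < `|K| + 1 by rewrite ltr_wpDl.
exists (f l) => e e0; have [|d d0 [cr cl']] := cl (e / (`|K| + 1)).
  by rewrite divr_gt0.
exists d => //; split => s.
  move=> ts sd; rewrite (le_trans (fB _ _))// mulrC -ler_pdivlMr//; exact: cr.
by move=> ? ts sd; rewrite (le_trans (fB _ _))// mulrC -ler_pdivlMr//; exact: cl'.
Qed.

Lemma rcll_cst (W : normedModType R) (k : W) : rcll (cst k).
Proof.
move=> t _; exists k => e e0; exists 1 => //.
by split=> *; rewrite subrr normr0 ltW.
Qed.

(** Near each [p] the path stays within distance 1 of [c p] or of the left limit [l]; interval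
    induction glues these local bounds. *)
Lemma rcll_bounded (W : normedModType R) (c : R -> W) T : rcll c -> 0 <= T ->
  exists2 C, 0 < C & forall s, 0 <= s <= T -> `|c s| <= C.
Proof.
move=> rc T0.
apply: (@interval_induction
  (fun a b => exists2 C, 0 < C & forall s, a <= s <= b -> `|c s| <= C)) => //.
  move=> a b e ab be [C1 C10 c1] [C2 C20 c2]; exists (Num.max C1 C2).
    by rewrite lt_max C10.
  move=> s /andP[as_ sc]; rewrite le_max.
  by have [sb|/ltW bs] := leP s b; [rewrite c1 ?as_ | rewrite c2 ?bs ?orbT].
move=> p /andP[p0 _]; have [l cl] := rc p p0.
have [d d0 [cr cl']] := cl 1 ltr01.
have cp0 : 0 < `|c p| + `|l| + 1 by rewrite ltr_wpDl// addr_ge0.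
exists d => //; split => a.
  move=> pa ad _; exists (`|c p| + `|l| + 1) => // s /andP[ps sa].
  have := cr s ps (le_lt_trans sa ad).
  have := ler_normD (c s - c p) (c p); rewrite subrK.
  have := normr_ge0 l; lra.
move=> a0 da ap; exists (`|c p| + `|l| + 1) => // s /andP[as_].
rewrite le_eqVlt => /orP[/eqP->|sp].
  have := normr_ge0 l; lra.
have := cl' s (le_trans a0 as_) (lt_le_trans da as_) sp.
have := ler_normD (c s - l) l; rewrite subrK.
have := normr_ge0 (c p); lra.
Qed.

(** By right-continuity, [f] is the pointwise limit of the step functions [h n], which sample [f] at
    the right end of the grid cell of mesh 1/(n+1) containing the argument. That end lies strictly
    to the right of [x]. *)
Lemma rcll_measurable (f : R -> R) a b : rcll f -> 0 <= a ->
  measurable_fun `[a, b] f.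
Proof.
move=> rf a0.
pose q n (x : R) : nat := Num.truncn (n.+1%:R * x).
pose h n x := f ((q n x).+1%:R / n.+1%:R).
apply: (@measurable_fun_cvg _ _ _ _ h).
  move=> n _ Y mY.
  rewrite (_ : _ `&` _ = \bigcup_(k in [set k | Y (f (k.+1%:R / n.+1%:R))])
    (`[a, b] `&` `[k%:R / n.+1%:R, k.+1%:R / n.+1%:R[)); last first.
    apply/seteqP; split => [x [xab Yx]|x [k /= Yk [xab]]].
      exists (q n x) => //; split => //.
      have x0 : 0 <= n.+1%:R * x.
        by rewrite mulr_ge0//; move: xab; rewrite /= in_itv/= => /andP[/(le_trans a0)].
      have /andP[q1 q2] := truncn_itv x0.
      by rewrite /= in_itv/= ler_pdivrMr// ltr_pdivlMr// [x * _]mulrC q1.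
    rewrite /= in_itv/= ler_pdivrMr// ltr_pdivlMr// => kx; split => //.
    rewrite /h /q /=; suff -> : Num.truncn (n.+1%:R * x) = k by [].
    by apply: truncn_def; rewrite mulrC.
  by apply: bigcup_measurable => k _; exact: measurableI.
move=> x; rewrite /= in_itv/= => /andP[ax _].
have x0 := le_trans a0 ax; have [l fl] := rf x x0.
apply/cvgrPdist_le => e e0; have [d d0 [fr _]] := fl e e0.
near=> n; rewrite distrC; have n0 : 0 < n.+1%:R :> R by rewrite ltr0n.
have /andP[q1 q2] := truncn_itv (mulr_ge0 (ltW n0) x0).
apply: fr; first by rewrite ler_pdivlMr// mulrC ltW.
rewrite ltr_pdivrMr// -[(q n x).+1%:R]natr1 mulrDl [x * _]mulrC ler_ltD//.
rewrite -ltr_pdivrMr// mul1r.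
by near: n; exact: (near_infty_natSinv_lt (PosNum d0)).
Unshelve. all: by end_near. Qed.

Lemma rcll_integrable (f : R -> R) a b : rcll f -> 0 <= a ->
  lebesgue_measure.-integrable `[a, b] (EFin \o f).
Proof.
move=> rf a0; have [ab|ba] := leP a b; last first.
  by rewrite set_itv_ge ?bnd_simp -?ltNge//; exact: integrable_set0.
have [C C0 fC] := rcll_bounded rf (le_trans a0 ab).
apply: measurable_bounded_integrable => //.
- exact/compact_finite_measure/segment_compact.
- exact: rcll_measurable.
- exists C; split; [exact: num_real|] => M CM x /=; rewrite in_itv/= => /andP[ax xb].
  by rewrite (le_trans _ (ltW CM))// fC// xb (le_trans a0).
Qed.

Lemma rcll_integral_split (f : R -> R) a b : rcll f -> 0 <= a -> a <= b ->
  I f 0 b = I f 0 a + I f a b.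
Proof.
move=> rf a0 ab; apply/eqP; rewrite addrC -subr_eq; apply/eqP.
rewrite (@Rintegral_itvB _ f (BLeft 0) (BRight b) a) ?bnd_simp//.
  apply: Rintegral_itv_obnd_cbnd.
  by apply: integrableS (rcll_integrable b rf a0) => //; exact: subset_itv_oc_cc.
exact: rcll_integrable.
Qed.

(** The endpoint [b] carries no mass, so no bound is asked there; this allows [L] to be a left limit
    at a jump in [b]. *)
Lemma rcll_integral_near (f : R -> R) a b L e : rcll f -> 0 <= a -> a <= b ->
  (forall s, a <= s -> s < b -> `|f s - L| <= e) ->
  `|I f a b - L * (b - a)| <= e * (b - a).
Proof.
move=> rf a0 ab fL.
have mab : fine (lebesgue_measure (`[a, b[ : set R)) = b - a.
  rewrite lebesgue_measure_itv/= lte_fin; case: ltP => [//|ba].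
  by have -> : a = b; [apply/eqP; rewrite eq_le ab | rewrite subrr].
have icst (k : R) : lebesgue_measure.-integrable (`[a, b[ : set R) (EFin \o cst k).
  apply: integrableS (rcll_integrable b (rcll_cst k) a0) => //.
  exact: subset_itv_co_cc.
have fi : lebesgue_measure.-integrable `[a, b[ (EFin \o f).
  by apply: integrableS (rcll_integrable b rf a0) => //; exact: subset_itv_co_cc.
rewrite -Rintegral_itv_bndo_bndc// -mab -!Rintegral_cst// -RintegralB//; last exact: icst.
have di : lebesgue_measure.-integrable `[a, b[ (EFin \o (fun s => f s - L)).
  exact: (integrableB _ fi (icst L)).
apply: (le_trans (le_normr_Rintegral _ di)) => //.
apply: le_Rintegral => //.
- exact: (integrable_norm di).
- exact: icst.
- by move=> s; rewrite /= in_itv/= => /andP[]; exact: fL.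
Qed.

(** The mean of [f] over a short interval to the right of [t] is zero, and by right-continuity it is
    close to [f t]. *)
Lemma rcll_integral_eq0 (f : R -> R) : rcll f ->
  (forall T, 0 <= T -> I f 0 T = 0) -> forall t, 0 <= t -> f t = 0.
Proof.
move=> rf f0 t t0; apply/normr0_eq0/eqP; rewrite eq_le normr_ge0 andbT.
apply/ler_addgt0Pl => e e0; rewrite addr0; have [l fl] := rf t t0.
have [d d0 [fr _]] := fl e e0.
have td : t <= t + d by rewrite lerDl ltW.
have := @rcll_integral_near f t (t + d) (f t) e rf t0 td fr.
have /eqP := rcll_integral_split rf t0 td.
rewrite !f0 ?(le_trans t0)// add0r eq_sym => /eqP->.
by rewrite sub0r (addrAC t) subrr add0r normrN normrM (gtr0_norm d0) ler_pM2r.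
Qed.

(* Uniform smallness of the increments replaces the mean value theorem. *)
Lemma eq_small_increments (phi : R -> R) T : 0 <= T ->
  (forall p e, 0 <= p <= T -> 0 < e -> exists2 d, 0 < d &
     (forall b, p <= b -> b < p + d -> b <= T ->
        `|phi b - phi p| <= e * (b - p)) /\
     (forall a, 0 <= a -> p - d < a -> a <= p ->
        `|phi p - phi a| <= e * (p - a))) ->
  phi T = phi 0.
Proof.
move=> T0 small; apply/eqP; rewrite -subr_eq0 -normr_eq0 eq_le normr_ge0 andbT.
apply/ler_addgt0Pl => e e0; rewrite addr0.
(* The increments add up to at most e T / (T + 1) <= e; adding 1 covers T = 0. *)
have e'0 : 0 < e / (T + 1) by rewrite divr_gt0// ltr_wpDl.
have : `|phi T - phi 0| <= e / (T + 1) * (T - 0).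
  apply: (@interval_induction
    (fun a b => `|phi b - phi a| <= e / (T + 1) * (b - a))) => //.
    move=> a b c _ _ qab qbc.
    rewrite (_ : c - a = (c - b) + (b - a)); last by rewrite addrA subrK.
    rewrite (_ : phi c - phi a = (phi c - phi b) + (phi b - phi a)).
      by rewrite mulrDr (le_trans (ler_normD _ _))// lerD.
    by rewrite addrA subrK.
  by move=> p pT; exact: small.
move=> /le_trans; apply; rewrite subr0 mulrAC ler_pdivrMr ?ltr_wpDl//.
by rewrite ler_pM2l// lerDl.
Qed.
End paths.

(** * Hilbert spaces *)

Section hilbert.
Context {R : realType} {H : completeNormedModType R} {ip : {dot H for @idfun R}}.
Hypothesis hip : norm_from_dot ip.
Implicit Types (x y z : H).

Lemma dotC x y : ip x y = ip y x.
Proof. by rewrite hermC expr0 mul1r. Qed.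

Lemma dotZl a x y : ip (a *: x) y = a * ip x y.
Proof. exact: linearZl_LR. Qed.

Lemma dotZr a x y : ip x (a *: y) = a * ip x y.
Proof. exact: linearZr_LR. Qed.

Lemma dotDl x y z : ip (x + y) z = ip x z + ip y z.
Proof. exact: linearDl. Qed.

Lemma dotDr x y z : ip x (y + z) = ip x y + ip x z.
Proof. exact: linearDr. Qed.

Lemma dotBl x y z : ip (x - y) z = ip x z - ip y z.
Proof. exact: linearBl. Qed.

Lemma dotBr x y z : ip x (y - z) = ip x y - ip x z.
Proof. exact: linearBr. Qed.

(** Cauchy-Schwarz, from the nonnegative square of |y|^2 x - <x, y> y. *)
Lemma norm_dot_le x y : `|ip x y| <= `|x| * `|y|.
Proof.
have [->|y0] := eqVneq y 0; first by rewrite linear0r !normr0 mulr0.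
have yy : 0 < `|y| by rewrite normr_gt0.
have : 0 <= ip (`|y| ^+ 2 *: x - ip x y *: y) (`|y| ^+ 2 *: x - ip x y *: y).
  by rewrite -hip sqr_ge0.
rewrite dotBl !dotBr !dotZl !dotZr (dotC y x) -!hip => h.
have : 0 <= `|y| ^+ 2 * (`|x| ^+ 2 * `|y| ^+ 2 - ip x y ^+ 2) by nra.
rewrite pmulr_rge0 ?exprn_gt0// subr_ge0 -exprMn => h2.
by rewrite -(ler_pXn2r (ltn0Sn 1)) ?nnegrE ?mulr_ge0// real_normK ?num_real.
Qed.

(** * The Riesz representation theorem, by minimization *)

Section riesz.
Variables (l : H -> R) (K : R).
Hypotheses (ls : scalar l) (lK : forall x, `|l x| <= K * `|x|).

(** The representing vector of [l] is the minimizer of this quadratic functional. *)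
Let J x := ip x x - 2 * l x.

Let JD x y s : J (x + s *: y) = J x + 2 * s * (ip x y - l y) + s ^+ 2 * ip y y.
Proof.
rewrite /J (addrC x) ls dotDl !dotDr !dotZl !dotZr (dotC y x).
ring.
Qed.

Let has_infJ : has_inf (range J).
Proof.
split; first by exists (J 0), 0.
(* Completing the square: |x|^2 - 2 K |x| >= - K^2. *)
exists (- K ^+ 2) => _ [x _ <-]; rewrite /J -hip.
have := lK x; have := ler_norm (l x); have := sqr_ge0 (`|x| - K); nra.
Qed.

Let m := inf (range J).

Let m_le x : m <= J x.
Proof. by apply: ge_inf; [case: has_infJ | exists x]. Qed.

(** This is [m <= J] at the midpoint of [x] and [y]. It makes minimizing sequences Cauchy. *)
Let parallelogram x y : `|x - y| ^+ 2 <= 2 * (J x - m) + 2 * (J y - m).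
Proof.
have := m_le (x + 2^-1 *: (y - x)); rewrite JD => mJ.
have lB : l (y - x) = l y - l x.
  by rewrite addrC -scaleN1r ls mulN1r addrC.
have h1 : ip (y - x) (y - x) = ip x x + ip y y - 2 * ip x y.
  rewrite dotBl !dotBr (dotC y x); ring.
have h2 : ip x (y - x) = ip x y - ip x x by rewrite dotBr.
have -> : `|x - y| ^+ 2 = ip (y - x) (y - x) by rewrite -hip distrC.
move: mJ; rewrite lB h1 h2 /J; lra.
Qed.

(** The limit [xi] of a minimizing sequence [u] works, since the first variation of [J] vanishes
    there: the inequality [m <= J (u n + s *: x)] is passed to the limit in [n], giving [pos]. *)
Lemma riesz_representation : exists xi, forall x, ip xi x = l x.
Proof.
have /choice[u Ju] : forall n, exists x, J x - m < n.+1%:R^-1.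
  move=> n.
  have n0 : 0 < n.+1%:R^-1 :> R by rewrite invr_gt0.
  have [_ [x _ <-] xm] := inf_adherent n0 has_infJ.
  by exists x; rewrite ltrBlDl.
have cu : cvg (u @ \oo).
  apply/cauchy_cvgP/cauchy_exP => e e0.
  have e4 : 0 < e ^+ 2 / 4 by rewrite divr_gt0// exprn_gt0.
  have [N _ HN] := near_infty_natSinv_lt (PosNum e4).
  exists (u N); exists N => // n Nn; rewrite -ball_normE /=.
  rewrite -(@ltr_pXn2r _ 2)// ?nnegrE ?(ltW e0)//.
  have := parallelogram (u N) (u n).
  move=> /le_lt_trans; apply.
  have JN := lt_trans (Ju N) (HN N (leqnn N)).
  have Jn := lt_trans (Ju n) (HN n Nn).
  rewrite (_ : e ^+ 2 = 2 * (e ^+ 2 / 4) + 2 * (e ^+ 2 / 4)); last by field.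
  by rewrite ltrD// ltr_pM2l.
pose xi : H := lim (u @ \oo); exists xi => x.
have near_u e : 0 < e -> exists n, `|xi - u n| <= e /\ n.+1%:R^-1 <= e.
  move=> e0; have /cvgrPdist_le/(_ _ e0)[N1 _ H1] := cu.
  have [N2 _ H2] := near_infty_natSinv_lt (PosNum e0).
  exists (maxn N1 N2); split; first by apply: H1; rewrite /= leq_maxl.
  by apply/ltW/H2; rewrite /= leq_maxr.
set D := ip xi x - l x.
have pos s : 0 <= 2 * s * D + s ^+ 2 * ip x x.
  apply/ler_addgt0Pl => e e0.
  have c0 : 0 < 1 + 2 * `|s| * `|x| by rewrite ltr_wpDr// !mulr_ge0.
  have [n [un nn]] := near_u (e / (1 + 2 * `|s| * `|x|)) (divr_gt0 e0 c0).
  have := m_le (u n + s *: x); have := Ju n; rewrite JD.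
  have : `|2 * s * (D - (ip (u n) x - l x))| <= 2 * `|s| * `|x| * `|xi - u n|.
    rewrite /D (_ : _ - _ - _ = ip (xi - u n) x); last first.
      by rewrite dotBl; ring.
    rewrite !normrM (ger0_norm (ler0n R 2)) -!mulrA !ler_wpM2l//.
    by rewrite mulrC norm_dot_le.
  move=> /ler_normlP[h1 _] h2 h3.
  have h4 : 2 * `|s| * `|x| * `|xi - u n| <=
      2 * `|s| * `|x| * (e / (1 + 2 * `|s| * `|x|)) by rewrite ler_wpM2l// !mulr_ge0.
  have : e / (1 + 2 * `|s| * `|x|) + 2 * `|s| * `|x| * (e / (1 + 2 * `|s| * `|x|)) = e.
    by rewrite -{1}[_ / _]mul1r -mulrDl mulrC divfK// gt_eqF.
  have aux (j k q n0 a b c g D' s2 e' : R) : - (2 * s * (D' - c)) <= b * g ->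
    j - n0 < k -> n0 <= j + 2 * s * c + s2 * q -> b * g <= b * a -> k <= a ->
    a + b * a = e' -> 0 <= e' + (2 * s * D' + s2 * q) by lra.
  exact: aux h1 h2 h3 h4 nn.
have xx0 : 0 <= ip x x by rewrite -hip sqr_ge0.
have q0 : 0 < ip x x + 1 by rewrite ltr_wpDl.
(* A nearly optimal [s] makes the quadratic expression a negative multiple of D^2, which forces D =
   0. Adding 1 to the denominator avoids a separate case x = 0. *)
have := pos (- D / (ip x x + 1)).
have -> : 2 * (- D / (ip x x + 1)) * D + (- D / (ip x x + 1)) ^+ 2 * ip x x =
  - (D ^+ 2 * ((ip x x + 2) / (ip x x + 1) ^+ 2)).
  by field; rewrite gt_eqF.
rewrite oppr_ge0 pmulr_lle0; last by rewrite divr_gt0 ?exprn_gt0// ltr_wpDl.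
move=> D2; apply/eqP; rewrite -subr_eq0 -/D -sqrf_eq0 eq_le D2; exact: sqr_ge0.
Qed.
End riesz.

(** * Orthogonal projection onto a finite dimensional subspace *)

Section finite_dimension.
Variable V : set H.
Hypothesis hV : fin_dim_subspace V.

Lemma fin_dim_linear a x y : V x -> V y -> V (a *: x + y).
Proof.
have [n [e ->]] := hV; move=> [c _ <-] [c' _ <-].
exists (fun i => a * c i + c' i) => //; rewrite scaler_sumr -big_split /=.
by apply: eq_bigr => i _; rewrite scalerDl scalerA.
Qed.

Lemma fin_dim0 : V 0.
Proof.
have [n [e ->]] := hV; exists (fun=> 0) => //.
by rewrite big1// => i _; rewrite scale0r.
Qed.

Lemma fin_dimD x y : V x -> V y -> V (x + y).
Proof. by move=> Vx Vy; rewrite -[x]scale1r; exact: fin_dim_linear. Qed.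

(** A Gram-Schmidt step: [y] and [u] are the residuals of [x] and of the last vector with respect to
    the first [n] vectors, and the component of [y] along [u] is then removed. Linear independence
    is not assumed. *)
Lemma span_orthogonal_decomposition n (e : 'I_n -> H) x : exists c : 'I_n -> R,
  forall i, ip (e i) (x - \sum_(j < n) c j *: e j) = 0.
Proof.
elim: n e x => [|n IH] e x; first by exists (fun=> 0); case.
pose e' i := e (lift ord_max i).
have widenE j : widen_ord (leqnSn n) j = lift ord_max j.
  by apply/val_inj; rewrite /= /bump leqNgt ltn_ord.
have [c1 h1] := IH e' x; have [c2 h2] := IH e' (e ord_max).
set y := x - _ in h1; set u := e ord_max - _ in h2.
(* If u = 0, the last vector already lies in the span of the others; the quotient is then 0 by
   convention and [suu] still holds. *)
pose s := ip u y / ip u u.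
have suu : s * ip u u = ip u y.
  rewrite /s; have [u0|u0] := eqVneq (ip u u) 0; last by rewrite divfK.
  rewrite u0 mulr0 (_ : u = 0) ?linear0l//.
  by apply/normr0_eq0/eqP; rewrite -sqrf_eq0 hip u0.
pose c (i : 'I_n.+1) := if unlift ord_max i is Some j then c1 j - s * c2 j else s.
have xc : x - \sum_(j < n.+1) c j *: e j = y - s *: u.
  rewrite big_ord_recr /= {2}/c unlift_none.
  rewrite (eq_bigr (fun j => c1 j *: e' j - s *: (c2 j *: e' j))).
    rewrite sumrB -scaler_sumr /y /u scalerBr !opprB opprD !opprB.
    by rewrite -!addrA; congr (_ + _); rewrite addrCA.
  by move=> j _; rewrite /c widenE liftK scalerBl scalerA.
have ue : e ord_max = u + \sum_(j < n) c2 j *: e' j by rewrite subrK.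
clearbody u; exists c => i; rewrite xc dotBr dotZr /=.
case: (unliftP ord_max i) => [j|] ->.
  by rewrite -/(e' j) h1 h2 mulr0 subr0.
have sum0 z : (forall i, ip (e' i) z = 0) -> ip (\sum_(j < n) c2 j *: e' j) z = 0.
  move=> z0; rewrite linear_sumlz big1// => j _.
  by rewrite [LHS]dotZl z0 mulr0.
by rewrite ue !dotDl !sum0// !addr0 suu subrr.
Qed.

Lemma fin_dim_orthogonal_decomposition x :
  exists2 v, V v & forall w, V w -> ip w (x - v) = 0.
Proof.
have [n [e ->]] := hV; have [c hc] := span_orthogonal_decomposition e x.
exists (\sum_(j < n) c j *: e j); first by exists c.
move=> _ [c' _ <-]; rewrite linear_sumlz big1// => j _.
by rewrite [LHS]dotZl hc mulr0.
Qed.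

(** The residual of the projection of [x] is an admissible [z], hence orthogonal to [x] and to
    itself. *)
Lemma fin_dim_biorthogonal x :
  (forall z, (forall w, V w -> ip w z = 0) -> ip z x = 0) -> V x.
Proof.
move=> xz; have [v Vv hv] := fin_dim_orthogonal_decomposition x.
suff /subr0_eq -> : x - v = 0 by [].
apply/normr0_eq0/eqP; rewrite -sqrf_eq0 hip dotBr xz//.
by rewrite dotC hv// subrr.
Qed.
End finite_dimension.
End hilbert.

(** * Semigroups and their generators *)

Section semigroup.
Context {R : realType} {H : completeNormedModType R} {ip : {dot H for @idfun R}}.
Hypothesis hip : norm_from_dot ip.
Context {S : R -> H -> H}.
Hypotheses (hS : c0_semigroup S) (hSpc : pseudo_contractive S).
Implicit Types (x y z : H) (s t T a b : R).

Lemma semigroup_linear t : 0 <= t -> linear (S t).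
Proof. by move=> t0; have [/(_ t t0)[]] := hS. Qed.

Lemma semigroupD t x y : 0 <= t -> S t (x + y) = S t x + S t y.
Proof.
by move=> t0; have := semigroup_linear t0 1 x y; rewrite !scale1r.
Qed.

Lemma semigroup0 t : 0 <= t -> S t 0 = 0.
Proof. by move=> t0; apply: (addrI (S t 0)); rewrite -semigroupD// !addr0. Qed.

Lemma semigroupZ t a x : 0 <= t -> S t (a *: x) = a *: S t x.
Proof.
by move=> t0; have := semigroup_linear t0 a x 0; rewrite semigroup0// !addr0.
Qed.

Lemma semigroupB t x y : 0 <= t -> S t (x - y) = S t x - S t y.
Proof. by move=> t0; rewrite -scaleN1r semigroupD// semigroupZ// scaleN1r. Qed.

Lemma semigroup_bounded T : exists2 K, 0 < K &
  forall t x, 0 <= t <= T -> `|S t x| <= K * `|x|.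
Proof.
have [omega So] := hSpc.
exists (expR (`|omega| * T)); first exact: expR_gt0.
move=> t x /andP[t0 tT]; rewrite (le_trans (So _ _ t0))// ler_wpM2r// ler_expR.
by rewrite (le_trans (ler_wpM2r t0 (ler_norm _)))// ler_wpM2l.
Qed.

Lemma semigroup_near0 x e : 0 < e -> exists2 d, 0 < d &
  forall h, 0 <= h -> h < d -> `|S h x - x| <= e.
Proof.
move=> e0; have [_ S0 _ /(_ x)/cvgrPdist_le/(_ _ e0)] := hS.
move=> [d /= d0 hd]; exists d => // h h0 hdd; rewrite distrC.
move: h0; rewrite le_eqVlt => /orP[/eqP<-|h0]; first by rewrite S0 subrr normr0 ltW.
by apply: hd => //=; rewrite sub0r normrN gtr0_norm.
Qed.

(** For s <= t the difference is S_s (S_{t-s} x - x), and the operators S_s are uniformly bounded on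
    [0, T]; continuity at 0 suffices. *)
Lemma semigroup_unif x T e : 0 < e -> exists2 d, 0 < d &
  forall s t, 0 <= s <= T -> 0 <= t <= T -> `|t - s| < d ->
    `|S t x - S s x| <= e.
Proof.
move=> e0; have [K K0 SK] := semigroup_bounded T.
have [d d0 hd] := semigroup_near0 x (divr_gt0 e0 K0).
have [_ _ Sadd _] := hS.
exists d => //.
suff le s t : 0 <= s <= T -> 0 <= t <= T -> s <= t -> t - s < d ->
    `|S t x - S s x| <= e.
  move=> s t sT tT; have [st|/ltW ts] := leP s t.
    by rewrite ger0_norm ?subr_ge0//; exact: le.
  by rewrite distrC ger0_norm ?subr_ge0// distrC; exact: le.
move=> sT /andP[t0 _] st std; have ts0 : 0 <= t - s by rewrite subr_ge0.
have /andP[s0 _] := sT.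
rewrite -[t](subrK s) (addrC _ s) Sadd// -semigroupB//.
by rewrite (le_trans (SK _ _ sT))// mulrC -ler_pdivlMr// hd.
Qed.

Lemma rcll_semigroup x : rcll (S ^~ x).
Proof.
move=> t t0; exists (S t x) => e e0.
have [d d0 hd] := semigroup_unif x (t + 1) e0.
have tt : 0 <= t <= t + 1 by rewrite t0 lerDl ler01.
exists (Num.min d 1); first by rewrite lt_min d0 ltr01.
split=> s.
  move=> ts; rewrite -ltrBlDl lt_min => /andP[sd s1].
  apply: hd => //; last by rewrite ger0_norm// subr_ge0.
  by rewrite (le_trans t0 ts) ltW// -ltrBlDl.
move=> s0; rewrite ltrBlDr -ltrBlDl lt_min => /andP[ts t1] st.
apply: hd => //; first by rewrite s0 (le_trans (ltW st))// lerDl ler01.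
by rewrite distrC ger0_norm// subr_ge0 ltW.
Qed.

Lemma semigroup_continuous x : {within `[0, +oo[, continuous (S ^~ x)}.
Proof.
apply/subspace_continuousP => t; rewrite /= in_itv/= andbT => t0.
apply/cvgrPdist_le => e e0; rewrite near_withinE.
have [d d0 hd] := semigroup_unif x (t + 1) e0.
exists (Num.min d 1); first by rewrite /= lt_min d0 ltr01.
move=> s; rewrite /= lt_min => /andP[sd s1]; rewrite in_itv/= andbT => s0.
apply: hd => //; rewrite ?s0 ?t0 ?lerDl ?ler01//=.
by move: s1; rewrite distrC => /(le_lt_trans (ler_norm _)); rewrite ltrBlDl => /ltW.
Qed.

Lemma rcll_dot (c : R -> H) z t : rcll c -> 0 <= t ->
  rcll (fun s => ip z (S t (c s))).
Proof.
move=> rc t0; have [K K0 SK] := semigroup_bounded t.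
apply: (@rcll_linear _ _ _ c (fun x => ip z (S t x)) (`|z| * K)) => //.
  by move=> a x y; rewrite semigroup_linear// dotDr dotZr.
move=> x; rewrite (le_trans (norm_dot_le hip _ _))// -mulrA ler_wpM2l// SK//.
by rewrite t0 lexx.
Qed.

Lemma rcll_dot_semigroup z x : rcll (fun s => ip z (S s x)).
Proof.
apply: (@rcll_linear _ _ _ (S ^~ x) (ip z) (`|z|)); last exact: rcll_semigroup.
  by move=> a u v; rewrite dotDr dotZr.
by move=> u; exact: norm_dot_le.
Qed.

(** * The generator and elements of the domain of its adjoint *)

Section generator.
Variables (DA : set H) (A : H -> H).
Hypothesis hA : generator S DA A.

Lemma generator_near0 x e : DA x -> 0 < e -> exists2 d, 0 < d &
  forall h, 0 <= h -> h < d -> `|S h x - x - h *: A x| <= e * h.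
Proof.
have [_ S0 _ _] := hS.
move=> Dx e0; have [_ /(_ x Dx)/cvgrPdist_le/(_ _ e0)] := hA.
move=> [d /= d0 hd]; exists d => // h h0 hdd.
move: h0; rewrite le_eqVlt => /orP[/eqP<-|h0].
  by rewrite S0 subrr scale0r subr0 normr0 mulr0.
have := hd h; rewrite /= sub0r normrN gtr0_norm// => /(_ hdd h0).
rewrite -(ler_pM2r h0); apply: le_trans.
rewrite -[X in _ * X](gtr0_norm h0) mulrC -normrZ scalerBr scalerA.
by rewrite divff ?gt_eqF// scale1r distrC.
Qed.

(** The difference of <z, S_u x> and the integral up to [u] has increments of small order
    everywhere, so it is constant by [eq_small_increments]. *)
Lemma dot_semigroup_integral x z t : DA x -> 0 <= t ->
  ip z (S t x) - ip z x = I (fun s => ip z (S s (A x))) 0 t.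
Proof.
move=> Dx t0; have [_ S0 Sadd _] := hS.
pose g s := ip z (S s (A x)).
have rg : rcll g by exact: rcll_dot_semigroup.
have : ip z (S t x) - I g 0 t = ip z (S 0 x) - I g 0 0.
  apply: (@eq_small_increments _ (fun u => ip z (S u x) - I g 0 u)) => // p e pt e0.
  have [K K0 SK] := semigroup_bounded t.
  have z0 : 0 < 1 + `|z| by rewrite ltr_wpDr.
  have e1 : 0 < e / (1 + `|z|) by rewrite divr_gt0.
  (* The generator remainder is amplified by |z| K and the oscillation of S_s A x by |z|; with this
     accuracy both together give e |z| / (1 + |z|) <= e per unit length. *)
  have e2 : 0 < e / (1 + `|z|) / (K + 1) by rewrite divr_gt0// addr_gt0.
  have [d1 d10 hd1] := generator_near0 Dx e2.
  have [d2 d20 hd2] := semigroup_unif (A x) t e2.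
  have main a b : 0 <= a -> a <= b -> b <= t -> b - a < Num.min d1 d2 ->
      `|ip z (S b x) - I g 0 b - (ip z (S a x) - I g 0 a)| <= e * (b - a).
    move=> a0 ab bt; rewrite lt_min => /andP[bad1 bad2].
    have a0t : 0 <= a <= t by rewrite a0 (le_trans ab).
    have ba0 : 0 <= b - a by rewrite subr_ge0.
    rewrite (rcll_integral_split rg a0 ab).
    have -> : S b x = S a x + S a (S (b - a) x - x - (b - a) *: A x)
                      + (b - a) *: S a (A x).
      rewrite !semigroupB// semigroupZ//.
      have -> : S b x = S a (S (b - a) x) by rewrite -Sadd// addrC subrK.
      by rewrite -addrA subrK [RHS]addrC subrK.
    have h1 : `|ip z (S a (S (b - a) x - x - (b - a) *: A x))| <=
              `|z| * (K * (e / (1 + `|z|) / (K + 1) * (b - a))).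
      rewrite (le_trans (norm_dot_le hip _ _))// ler_wpM2l//.
      by rewrite (le_trans (SK _ _ a0t))// ler_wpM2l ?(ltW K0)// hd1.
    have h2 : `|I g a b - g a * (b - a)| <=
              `|z| * (e / (1 + `|z|) / (K + 1)) * (b - a).
      apply: rcll_integral_near => // s as_ sb.
      rewrite /g -dotBr (le_trans (norm_dot_le hip _ _))// ler_wpM2l//.
      apply: hd2 => //.
        by rewrite (le_trans a0 as_) (le_trans (ltW sb)).
      by rewrite ger0_norm ?subr_ge0// (le_lt_trans _ bad2)// lerD2r ltW.
    rewrite !dotDr dotZr -/(g a).
    set u := ip z (S a (_ - _)) in h1 *.
    rewrite (_ : _ - _ = u - (I g a b - g a * (b - a))); last by ring.
    rewrite (le_trans (ler_normB _ _))// (le_trans (lerD h1 h2))//.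
    have -> : `|z| * (K * (e / (1 + `|z|) / (K + 1) * (b - a))) +
        `|z| * (e / (1 + `|z|) / (K + 1)) * (b - a) =
        e * (b - a) * (`|z| / (1 + `|z|)).
      by field; rewrite !gt_eqF// addr_gt0.
    rewrite ler_piMr ?mulr_ge0 ?(ltW e0)// ler_pdivrMr// mul1r lerDr ler01//.
  exists (Num.min d1 d2); first by rewrite lt_min d10.
  have /andP[p0 pt'] := pt.
  split=> [b pb bd bt|a a0 ad ap]; apply: main => //; first by rewrite ltrBlDl.
  by rewrite ltrBlDr -ltrBlDl.
rewrite S0 [I g 0 0](_ : _ = 0) ?subr0; last first.
  by rewrite set_itv1 Rintegral_set1.
by move=> <-; rewrite opprB addrCA subrr addr0.
Qed.

(** Riesz provides [zeta] = S_t^* z. *)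
Lemma semigroup_dot_adjoint z t : 0 <= t ->
  exists zeta, forall x, ip zeta x = ip z (S t x).
Proof.
move=> t0; have [K K0 SK] := semigroup_bounded t.
apply: (riesz_representation hip (K := `|z| * K)).
  by move=> a x y; rewrite semigroup_linear// dotDr dotZr.
move=> x; rewrite (le_trans (norm_dot_le hip _ _))// -mulrA ler_wpM2l// SK//.
by rewrite t0 lexx.
Qed.

Lemma adjoint_graph_average z t : 0 <= t -> exists xi eta,
  [/\ adjoint_graph ip DA A xi eta,
      forall x, ip xi x = I (fun s => ip z (S s x)) 0 t
    & forall x, ip eta x = ip z (S t x) - ip z x].
Proof.
move=> t0; have [zeta hzeta] := semigroup_dot_adjoint z t0.
have [K K0 SK] := semigroup_bounded t.
have int x : lebesgue_measure.-integrable `[0, t]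
    (EFin \o (fun s => ip z (S s x))).
  by apply: rcll_integrable => //; exact: rcll_dot_semigroup.
have [|x|xi hxi] := @riesz_representation _ _ _ hip
    (fun x => I (fun s => ip z (S s x)) 0 t) (`|z| * K * t).
- move=> a x y /=; rewrite -RintegralZl// -RintegralD//; last first.
    exact: (integrableZl _ a (int x)).
  apply: eq_Rintegral => s; rewrite inE/= in_itv/= => /andP[s0 _].
  by rewrite semigroup_linear// dotDr dotZr.
- have := @rcll_integral_near _ _ 0 t 0 (`|z| * K * `|x|) (rcll_dot_semigroup z x)
    (lexx 0) t0.
  rewrite mul0r !subr0 (mulrAC (`|z| * K)); apply => s s0 st; rewrite subr0.
  rewrite (le_trans (norm_dot_le hip _ _))// -mulrA ler_wpM2l// SK//.
  by rewrite s0 ltW.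
exists xi, (zeta - z); split=> // x; last by rewrite dotBl hzeta.
by move=> Dx; rewrite hxi -dot_semigroup_integral// dotBl hzeta.
Qed.
End generator.
End semigroup.

(** * Invariance of [V] under the semigroup *)

Section invariance.
Context {R : realType} {H : completeNormedModType R} {ip : {dot H for @idfun R}}.
Hypothesis hip : norm_from_dot ip.
Context {S : R -> H -> H}.
Hypotheses (hS : c0_semigroup S) (hSpc : pseudo_contractive S).
Variables (DA : set H) (A : H -> H).
Hypothesis hA : generator S DA A.
Variable V : set H.
Hypotheses (hV : fin_dim_subspace V) (hVA : operator_invariant DA A V).

(* For z orthogonal to V, the functions f_i(t) = <z, S_t e_i> satisfy the linear
   system f_i = \int_0^t \sum_j a_ij f_j, which on a short interval contracts
   their common bound by a factor 1/2. *)
Lemma semigroup_invariant_short : exists2 d, 0 < d &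
  forall t v, 0 <= t <= d -> V v -> V (S t v).
Proof.
have [n [e Ve]] := hV.
have VDA : V `<=` DA by case: hVA.
have Vei i : V (e i).
  rewrite Ve; exists (fun j => (j == i)%:R) => //.
  by rewrite (bigD1 i)//= eqxx scale1r big1 ?addr0// => j /negPf->; rewrite scale0r.
have /choice[a ha] : forall i, exists c : 'I_n -> R,
    A (e i) = \sum_(j < n) c j *: e j.
  move=> i; have : V (A (e i)) by case: hVA => _; apply; exists (e i).
  by rewrite {1}Ve => -[c _ <-]; exists c.
(* [C] dominates every absolute row sum of the matrix of [A] on [V], so integrating over a time of
   at most 1/(2C) yields the factor 1/2. *)
pose C := 1 + \sum_(i < n) \sum_(j < n) `|a i j|.
have C0 : 0 < C by rewrite ltr_wpDr// sumr_ge0// => i _; rewrite sumr_ge0.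
have Ci i : \sum_(j < n) `|a i j| <= C.
  rewrite /C [X in 1 + X](bigD1 i)//= addrCA lerDl addr_ge0// sumr_ge0// => j _.
  by rewrite sumr_ge0.
pose d := (2 * C)^-1; have d0 : 0 < d by rewrite invr_gt0 mulr_gt0.
exists d => // t v td Vv; have t0 : 0 <= t by case/andP: td.
apply: (fin_dim_biorthogonal hip hV) => z zV.
have [K K0 SK] := semigroup_bounded hSpc d.
(* The bound common to all f_i from which the iteration starts. *)
pose B := 1 + \sum_(i < n) `|z| * (K * `|e i|).
have halve k : forall i s, 0 <= s <= d -> `|ip z (S s (e i))| <= B / 2 ^+ k.
  elim: k => [|k IH] i s sd.
    rewrite expr0 divr1 (le_trans (norm_dot_le hip _ _))//.
    rewrite /B [X in 1 + X](bigD1 i)//= addrCA -[leLHS]addr0 lerD//.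
      by rewrite ler_wpM2l// SK.
    by rewrite addr_ge0// sumr_ge0// => j _; rewrite !mulr_ge0// ltW.
  have /andP[s0 sd'] := sd.
  have := dot_semigroup_integral hip hS hSpc hA z (VDA _ (Vei i)) s0.
  rewrite [ip z (e i)]dotC zV// subr0 => ->.
  have := @rcll_integral_near _ _ 0 s 0 (C * (B / 2 ^+ k))
    (rcll_dot_semigroup hip hS hSpc z (A (e i))) (lexx 0) s0.
  rewrite mul0r !subr0 => h; rewrite (le_trans (h _))//.
    move=> u u0 us; rewrite subr0 ha (_ : S u _ = \sum_(j < n) a i j *: S u (e j)).
      rewrite linear_sumr (le_trans (ler_norm_sum _ _ _))//.
      have ud : 0 <= u <= d by rewrite u0 (le_trans (ltW us)).
      apply: (@le_trans _ _ (\sum_(j < n) `|a i j| * (B / 2 ^+ k))).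
        apply: ler_sum => j _; rewrite [X in `|X|]dotZr normrM ler_wpM2l//.
        exact: IH.
      rewrite -mulr_suml ler_wpM2r//.
      exact: le_trans (IH i u ud).
    elim/big_ind2: _ => //; first exact: semigroup0.
      by move=> x1 x2 y1 y2 <- <-; rewrite semigroupD.
    by move=> j _; rewrite semigroupZ.
  have B0 : 0 <= B / 2 ^+ k by exact: le_trans (IH i s sd).
  have -> : B / 2 ^+ k.+1 = C * (B / 2 ^+ k) * d.
    by rewrite exprSr /d; field; rewrite (gt_eqF C0) expf_neq0 // pnatr_eq0.
  by rewrite ler_wpM2l// mulr_ge0// ltW.
have zero i : ip z (S t (e i)) = 0.
  apply/normr0_eq0/eqP; rewrite eq_le normr_ge0 andbT.
  apply/ler_addgt0Pl => eps eps0; rewrite addr0.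
  have B0 : 0 <= B.
    by have := halve 0%N i t td; rewrite expr0 divr1; exact: le_trans.
  have B10 : 0 < B + 1 by rewrite ltr_wpDl.
  have [N _ HN] := near_infty_natSinv_expn_lt (PosNum (divr_gt0 eps0 B10)).
  rewrite (le_trans (halve N i t td))//.
  have := HN N (leqnn N); rewrite /= mul1r => h.
  rewrite (le_trans (ler_wpM2l B0 (ltW h)))// mulrCA ler_piMr ?(ltW eps0)//.
  by rewrite ler_pdivrMr// mul1r lerDl.
move: Vv; rewrite {1}Ve => -[c _ <-].
rewrite (_ : S t _ = \sum_(j < n) c j *: S t (e j)).
  rewrite linear_sumr big1// => j _; by rewrite [LHS]dotZr zero mulr0.
elim/big_ind2: _ => //; first exact: semigroup0.
  by move=> x1 x2 y1 y2 <- <-; rewrite semigroupD.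
by move=> j _; rewrite semigroupZ.
Qed.

(** The time [t] is cut into [n] equal steps of length at most [d], and the semigroup law iterates
    the short-time case. *)
Lemma semigroup_invariant t v : 0 <= t -> V v -> V (S t v).
Proof.
move=> t0 Vv; have [d d0 hd] := semigroup_invariant_short.
have [_ S0 Sadd _] := hS.
pose n := (Num.truncn (t / d)).+1.
have n0 : 0 < n%:R :> R by rewrite ltr0n.
have tn : t / n%:R <= d.
  by rewrite ler_pdivrMr// mulrC -ler_pdivrMr// ltW// truncnS_gt.
have tn0 : 0 <= t / n%:R by rewrite divr_ge0// ltW.
have it k : V (S (t / n%:R * k%:R) v).
  elim: k => [|k IH]; first by rewrite mulr0 S0.
  rewrite -natr1 mulrDr mulr1 addrC Sadd//; last by rewrite mulr_ge0.
  by apply: hd => //; rewrite tn0.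
by have := it n; rewrite divfK// gt_eqF.
Qed.

Lemma semigroup_dot_eq0 z t v : (forall w, V w -> ip w z = 0) -> 0 <= t ->
  V v -> ip z (S t v) = 0.
Proof. by move=> zV t0 Vv; rewrite dotC zV//; exact: semigroup_invariant. Qed.

End invariance.

(** * The transport equation *)

Lemma rcllB {R : realType} (W : normedModType R) (c c' : R -> W) :
  rcll c -> rcll c' -> rcll (fun s => c s - c' s).
Proof.
move=> rc rc' t t0; have [l cl] := rc t t0; have [l' cl'] := rc' t t0.
exists (l - l') => e e0; have e20 : 0 < e / 2 by rewrite divr_gt0.
have [d d0 [r1 l1]] := cl _ e20; have [d' d'0 [r2 l2]] := cl' _ e20.
have split2 (x y x' y' : W) : `|x - y| <= e / 2 -> `|x' - y'| <= e / 2 ->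
    `|x - x' - (y - y')| <= e.
  move=> h1 h2; rewrite (splitr e) (_ : _ - _ = (x - y) - (x' - y')).
    by rewrite (le_trans (ler_normB _ _))// lerD.
  by rewrite !opprB addrACA [RHS]addrACA (addrC (- x')).
exists (Num.min d d'); first by rewrite lt_min d0.
split=> s.
  move=> ts; rewrite -ltrBlDl lt_min !ltrBlDl => /andP[sd sd'].
  by apply: split2; [apply: r1 | apply: r2].
move=> s0; rewrite ltrBlDr -ltrBlDl lt_min !ltrBlDl -!ltrBlDr => /andP[sd sd'] st.
by apply: split2; [apply: l1 | apply: l2].
Qed.

Section transport.
Context {R : realType} {H : completeNormedModType R} {ip : {dot H for @idfun R}}.
Hypothesis hip : norm_from_dot ip.
Context {S : R -> H -> H}.
Hypotheses (hS : c0_semigroup S) (hSpc : pseudo_contractive S).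

(** Passing through S_s y separates the change of vector, controlled by uniform boundedness, from
    the change of time, controlled by [semigroup_unif]. *)
Lemma semigroup_joint T y e : 0 < e -> exists2 d, 0 < d &
  forall s t x, 0 <= s <= T -> 0 <= t <= T -> `|s - t| < d -> `|x - y| <= d ->
    `|S s x - S t y| <= e.
Proof.
move=> e0; have [K K0 SK] := semigroup_bounded hSpc T.
have e20 : 0 < e / 2 by rewrite divr_gt0.
have [d d0 hd] := semigroup_unif hS hSpc y T e20.
exists (Num.min d (e / 2 / K)); first by rewrite lt_min d0 divr_gt0.
move=> s t x sT tT; rewrite lt_min le_min => /andP[std _] /andP[_ xy].
rewrite (splitr e) -(subrKA (S s y)) (le_trans (ler_normD _ _))//.
rewrite lerD ?hd// -(semigroupB hS); last by case/andP: sT.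
by rewrite (le_trans (SK _ _ sT))// mulrC -ler_pdivlMr.
Qed.

Lemma dot_semigroup_joint z T y e : 0 < e -> exists2 d, 0 < d &
  forall s t x, 0 <= s <= T -> 0 <= t <= T -> `|s - t| < d -> `|x - y| <= d ->
    `|ip z (S s x) - ip z (S t y)| <= e.
Proof.
move=> e0; have z0 : 0 < 1 + `|z| by rewrite ltr_wpDr.
have [d d0 hd] := semigroup_joint T y (divr_gt0 e0 z0).
exists d => // s t x sT tT st xy.
rewrite -dotBr (le_trans (norm_dot_le hip _ _))//.
rewrite (le_trans (ler_wpM2l _ (hd _ _ _ sT tT st xy)))//.
by rewrite mulrCA ler_piMr ?(ltW e0)// ler_pdivrMr// mul1r lerDr.
Qed.

Section path.
Variables (c : R -> H) (h z : H).
Hypothesis rc : rcll c.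

Let F u x := ip z (S u x).
(** The defect in the identity obtained by testing the weak formulation with [xi], for a single path
    [c] started at [h]. *)
Let E t u := I (fun s => F s (c t - h)) 0 u -
  (I (fun s => F u (c s)) 0 t - I (fun s => F 0 (c s)) 0 t).

Let rF u : 0 <= u -> rcll (fun s => F u (c s)).
Proof. exact: rcll_dot. Qed.

Let rFS x : rcll (F^~ x).
Proof. exact: rcll_dot_semigroup. Qed.

Hypothesis Erat : forall (q : rat) t, 0 <= (ratr q : R) -> 0 <= t ->
  E t (ratr q) = 0.

(** A path with one-sided limits has relatively compact range on [0, t], so continuity in time is
    uniform along it. Interval induction replaces compactness, with joint continuity used at [c p]
    and at the left limit [l]. *)
Lemma semigroup_path_unif u t e : 0 <= u -> 0 <= t -> 0 < e ->
  exists2 d, 0 < d & forall v, 0 <= v -> `|v - u| < d ->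
    forall s, 0 <= s <= t -> `|F v (c s) - F u (c s)| <= e.
Proof.
move=> u0 t0 e0; have e20 : 0 < e / 2 by rewrite divr_gt0.
apply: (@interval_induction _ (fun a b => exists2 d, 0 < d & forall v, 0 <= v ->
    `|v - u| < d -> forall s, a <= s <= b -> `|F v (c s) - F u (c s)| <= e)) => //.
  move=> a b b' ab bb' [d1 d10 h1] [d2 d20 h2].
  exists (Num.min d1 d2); first by rewrite lt_min d10.
  move=> v v0; rewrite lt_min => /andP[vd1 vd2] s /andP[as_ sb'].
  have [sb|/ltW bs] := leP s b; first by apply: h1 => //; rewrite as_.
  by apply: h2 => //; rewrite bs.
move=> p /andP[p0 _]; have [l hl] := rc p0.
have uu : 0 <= u <= u + 1 by rewrite u0 lerDl ler01.
have tri y d : 0 < d -> (forall s v x, 0 <= s <= u + 1 -> 0 <= v <= u + 1 ->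
    `|s - v| < d -> `|x - y| <= d -> `|ip z (S s x) - ip z (S v y)| <= e / 2) ->
    forall x, `|x - y| <= d -> forall v, 0 <= v -> `|v - u| < Num.min d 1 ->
    `|F v x - F u x| <= e.
  move=> d0 hd x xy v v0; rewrite lt_min => /andP[vd v1].
  have vu : 0 <= v <= u + 1.
    by rewrite v0/= -lerBlDl (le_trans (ler_norm _))// ltW.
  rewrite (splitr e) -(subrKA (F u y)) (le_trans (ler_normD _ _))// lerD//.
    exact: hd.
  by rewrite distrC hd// subrr normr0.
have [d d0 hd] := dot_semigroup_joint z (u + 1) (c p) e20.
have [d' d'0 hd'] := dot_semigroup_joint z (u + 1) l e20.
have [d1 d10 [hr _]] := hl _ d0; have [d2 d20 [_ hl']] := hl _ d'0.
exists (Num.min d1 d2); first by rewrite lt_min d10.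
split=> [b pb bd bt|a a0 ad ap].
  exists (Num.min d 1); first by rewrite lt_min d0 ltr01.
  move=> v v0 vu s /andP[ps sb]; apply: (tri _ _ d0 hd) => //; apply: hr => //.
  by move: bd; rewrite -ltrBlDl lt_min !ltrBlDl => /andP[/(le_lt_trans sb)].
(* Before [p] the values are close to [l], but at s = p the value is [c p], so both radii enter. *)
exists (Num.min (Num.min d 1) (Num.min d' 1)); first by rewrite !lt_min d0 d'0 ltr01.
move=> v v0; rewrite lt_min => /andP[vd vd'] s /andP[as_].
rewrite le_eqVlt => /orP[/eqP->|sp].
  by apply: (tri _ _ d0 hd) => //; rewrite subrr normr0 ltW.
apply: (tri _ _ d'0 hd') => //; apply: hl' => //; first exact: le_trans as_.
move: ad; rewrite ltrBlDr -ltrBlDl lt_min => /andP[_].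
by rewrite ltrBlDl -ltrBlDr => /lt_le_trans; apply.
Qed.

(** Rationals approach [u] from the right: the first integral in [E] varies little because its
    integrand is bounded, the second by [semigroup_path_unif]. *)
Let Ereal u t : 0 <= u -> 0 <= t -> E t u = 0.
Proof.
move=> u0 t0; apply/normr0_eq0/eqP; rewrite eq_le normr_ge0 andbT.
apply/ler_addgt0Pl => e e0; rewrite addr0.
have [C C0 hC] := rcll_bounded (rFS (c t - h)) (addr_ge0 u0 ler01).
have Ct : 0 < C + t by rewrite ltr_pwDl.
have e'0 : 0 < e / (C + t) by rewrite divr_gt0.
have [d d0 hd] := semigroup_path_unif u0 t0 e'0.
(* The bound 1 keeps the rational inside [0, u + 1], where [C] applies; the last bound makes the two
   errors add up to (C + t) e / (C + t) = e. *)
pose d' := Num.min d (Num.min 1 (e / (C + t))).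
have d'0 : 0 < d' by rewrite !lt_min d0 ltr01.
have [q] : exists q : rat, ratr q \in `]u, u + d'[ by apply: rat_in_itvoo; rewrite ltrDl.
rewrite in_itv/= => /andP[uq qd].
have quE : `|ratr q - u| = ratr q - u by rewrite ger0_norm// subr_ge0 ltW.
have : `|ratr q - u| < d' by rewrite quE ltrBlDl.
rewrite !lt_min => /andP[qd1 /andP[q1 qe]].
have q0 : 0 <= (ratr q : R) by exact: le_trans (ltW uq).
rewrite -normrN -[- _]add0r -(Erat q0 t0) /E.
rewrite (rcll_integral_split (rFS _) u0 (ltW uq)).
set i1 := Rintegral _ _ _; set i2 := Rintegral _ _ _.
set i3 := Rintegral _ _ _; set i4 := Rintegral _ _ _.
set i5 := Rintegral _ _ _.
rewrite (_ : _ - _ = i2 - (i3 - i5)); last by ring.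
have -> : i3 - i5 = I (fun s => F (ratr q) (c s) - F u (c s)) 0 t.
  rewrite -RintegralB//; first exact/rcll_integrable/lexx/rF.
  exact/rcll_integrable/lexx/rF.
have h1 : `|i2 - 0 * (ratr q - u)| <= C * (ratr q - u).
  apply: rcll_integral_near => //; first exact: ltW.
  move=> s us sq; rewrite subr0 hC// (le_trans u0 us)/=.
  rewrite (le_trans (ltW sq))// -lerBlDl (le_trans _ (ltW q1))// quE.
  exact: lexx.
have h2 : `|I (fun s => F (ratr q) (c s) - F u (c s)) 0 t - 0 * (t - 0)| <=
     e / (C + t) * (t - 0).
  apply: rcll_integral_near => //; first exact: rcllB (rF q0) (rF u0).
  by move=> s s0 st; rewrite subr0 hd// s0 ltW.
rewrite !mul0r !subr0 in h1 h2.
rewrite (le_trans (ler_normB _ _))// (le_trans (lerD h1 h2))//.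
apply: (@le_trans _ _ (C * (e / (C + t)) + e / (C + t) * t)).
  by rewrite lerD2r ler_wpM2l ?(ltW C0)// -quE ltW.
by rewrite mulrC -mulrDr divfK// gt_eqF.
Qed.

(** A potential whose formal partial derivatives are both [F u (c t)]: the one in [t] by
    construction, the one in [u] by [Ereal]. Hence it solves the transport equation. *)
Let Psi u t := I (fun s => F u (c s)) 0 t + I (F^~ h) 0 u.

Let Psi_left u v t : 0 <= u -> u <= v -> 0 <= t ->
  Psi v t - Psi u t = I (F^~ (c t)) u v.
Proof.
move=> u0 uv t0; have v0 := le_trans u0 uv.
have -> : I (F^~ (c t)) u v = I (fun s => F s (c t - h)) u v + I (F^~ h) u v.
  rewrite -RintegralD//; [|exact/rcll_integrable/u0/rFS..].
  apply: eq_Rintegral => s; rewrite inE/= in_itv/= => /andP[us _].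
  by rewrite -dotDr -(semigroupD hS) ?subrK// (le_trans u0).
have := Ereal v0 t0; have := Ereal u0 t0; rewrite /E /Psi.
rewrite !(rcll_integral_split (rFS _) u0 uv).
set i1 := Rintegral _ _ _; set i2 := Rintegral _ _ _.
set i3 := Rintegral _ _ _; set i4 := Rintegral _ _ _.
set i5 := Rintegral _ _ _; set i6 := Rintegral _ _ _.
set i7 := Rintegral _ _ _; move=> e1 e2. lra.
Qed.

Let Psi_right u a b : 0 <= u -> 0 <= a -> a <= b ->
  Psi u b - Psi u a = I (fun s => F u (c s)) a b.
Proof.
move=> u0 a0 ab; rewrite /Psi (rcll_integral_split (rF u0) a0 ab); ring.
Qed.

(* phi(s) = Psi (T - s) s is constant: its derivative along the characteristic
   u + s = T vanishes. *)
Lemma transport_integral T : 0 <= T ->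
  I (fun s => F 0 (c s)) 0 T = I (F^~ h) 0 T.
Proof.
move=> T0.
have I00 (f : R -> R) : I f 0 0 = 0 by rewrite set_itv1 Rintegral_set1.
have -> : I (fun s => F 0 (c s)) 0 T = Psi (T - T) T.
  by rewrite /Psi subrr I00 addr0.
have -> : I (F^~ h) 0 T = Psi (T - 0) 0 by rewrite /Psi I00 add0r subr0.
apply: (@eq_small_increments _ (fun s => Psi (T - s) s)) => // p e.
move=> /andP[p0 pT] e0; have e20 : 0 < e / 2 by rewrite divr_gt0.
have [l hl] := rc p0.
have [d d0 hd] := dot_semigroup_joint z T (c p) e20.
have [d' d'0 hd'] := dot_semigroup_joint z T l e20.
have [d1 d10 [hr _]] := hl _ d0; have [d2 d20 [_ hl']] := hl _ d'0.
have Tp : 0 <= T - p <= T by rewrite subr_ge0 pT lerBlDr lerDl.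
(* The increment of phi is a difference of two integrals over intervals of equal length, one in time
   and one in [u]; both are compared with the same rectangle. *)
have fin (x y L a b : R) : `|x - L * (b - a)| <= e / 2 * (b - a) ->
    `|y - L * (b - a)| <= e / 2 * (b - a) -> `|x - y| <= e * (b - a).
  move=> hx hy; rewrite [in leRHS](splitr e) mulrDl.
  by rewrite -(subrKA (L * (b - a))) (le_trans (ler_normD _ _))// lerD// distrC.
exists (Num.min (Num.min d d1) (Num.min d' d2)).
  by rewrite !lt_min d0 d10 d'0.
split=> [b pb|a a0].
  rewrite -ltrBlDl !lt_min => /andP[/andP[bd bd1] _] bT.
  have TbTp : T - b <= T - p by rewrite lerB.
  have Tb0 : 0 <= T - b by rewrite subr_ge0.
  have /andP[Tp0 _] := Tp.
  rewrite (_ : _ - _ = I (fun s => F (T - p) (c s)) p b - I (F^~ (c b)) (T - b) (T - p)).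
    apply: (fin _ _ (F (T - p) (c p))).
      apply: rcll_integral_near => //; first exact: rF.
      move=> s ps sb; apply: hd => //; first by rewrite subrr normr0.
      by apply: hr => //; rewrite -ltrBlDl (lt_trans _ bd1)// ltrD2r.
    rewrite (_ : b - p = T - p - (T - b)); last by ring.
    apply: rcll_integral_near => // s Tbs sTp; apply: hd => //.
    - by rewrite (le_trans Tb0 Tbs) (le_trans (ltW sTp))//; case/andP: Tp.
    - rewrite distrC ger0_norm ?subr_ge0 ?(ltW sTp)//.
      by rewrite (le_lt_trans _ bd)// (le_trans (lerB (lexx _) Tbs))//; lra.
    - by apply: hr => //; rewrite -ltrBlDl.
  by rewrite -(Psi_right Tp0 p0 pb) -(Psi_left Tb0 TbTp (le_trans p0 pb)); ring.
rewrite ltrBlDr -ltrBlDl !lt_min => /andP[_ /andP[pd pd2]] ap.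
have TpTa : T - p <= T - a by rewrite lerB.
have /andP[Tp0 TpT] := Tp.
rewrite (_ : _ - _ = I (fun s => F (T - p) (c s)) a p - I (F^~ (c a)) (T - p) (T - a)).
  (* On the left of [p] the common value is built from the left limit [l]. This requires a < p,
     since [c p] may differ from [l]; for a = p both integrals vanish. *)
  move: ap; rewrite le_eqVlt => /orP[/eqP ap|ap].
    by rewrite ap !set_itv1 !Rintegral_set1 !subrr normr0 mulr0.
  apply: (fin _ _ (F (T - p) l)).
    apply: rcll_integral_near => //; [exact: rF | exact: ltW |].
    move=> s as_ sp; apply: hd' => //; first by rewrite subrr normr0.
    apply: hl' => //; first exact: le_trans as_.
    by rewrite ltrBlDr -ltrBlDl (le_lt_trans _ pd2)// lerB.
  rewrite (_ : p - a = T - a - (T - p)); last by ring.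
  apply: rcll_integral_near => // s Tps sTa; apply: hd' => //.
  - by rewrite (le_trans Tp0 Tps) (le_trans (ltW sTa))// lerBlDr lerDl.
  - by rewrite ger0_norm ?subr_ge0//; lra.
  - by apply: hl' => //; rewrite ltrBlDr -ltrBlDl.
rewrite -(Psi_right Tp0 a0 ap) -(Psi_left Tp0 TpTa a0); ring.
Qed.

(** By [transport_integral] the integral of this function over every [0, T] is zero, and the
    function is right-continuous. *)
Lemma transport_unique t : 0 <= t -> ip z (c t - S t h) = 0.
Proof.
have [_ S0 _ _] := hS.
move: t; apply: (@rcll_integral_eq0 _ (fun t => ip z (c t - S t h))).
  apply: (@rcll_linear _ _ _ (fun t => c t - S t h) (ip z) (`|z|)).
  - by move=> a u v; rewrite dotDr dotZr.
  - by move=> u; exact: norm_dot_le.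
  - exact/(rcllB rc)/rcll_semigroup.
move=> T T0.
have -> : I (fun t => ip z (c t - S t h)) 0 T = I (fun s => F 0 (c s) - F s h) 0 T.
  by apply: eq_Rintegral => s _; rewrite /F S0 dotBr.
rewrite RintegralB//; first last.
- by apply: rcll_integrable; [exact: rFS|].
- by apply: rcll_integrable; [exact: rF|].
by rewrite transport_integral// subrr.
Qed.
End path.
End transport.

(** * Weak solutions *)

Lemma cadlag_rcll {R : realType} {disp} {T : measurableType disp} (W : normedModType R)
    (Y : R -> T -> W) w : cadlag Y -> rcll (Y ^~ w).
Proof.
move=> cY t t0; have [cr cl] := cY w t t0.
have right e : 0 < e -> exists2 d, 0 < d &
    forall s, t <= s -> s < t + d -> `|Y s w - Y t w| <= e.
  move=> e0; move/cvgrPdist_le : cr => /(_ e e0)[d /= d0 hd]; exists d => // s.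
  rewrite le_eqVlt => /orP[/eqP<- _|ts sd]; first by rewrite subrr normr0 ltW.
  rewrite distrC; apply: hd => //=.
  by rewrite distrC gtr0_norm ?subr_gt0// ltrBlDl.
move: t0; rewrite le_eqVlt => /orP[/eqP t0|t0].
  (* At t = 0 the condition on the left is vacuous and any value serves as left limit. *)
  exists 0 => e /right[d d0 hd]; exists d => //; split=> // s s0 _.
  by rewrite -t0 ltNge s0.
have /cvgrPdist_le hl := cl t0.
exists (lim (Y s w @[s --> t^'-])) => e e0.
have [d d0 hd] := right e e0; have [d' /= d'0 hd'] := hl e e0.
exists (Num.min d d'); first by rewrite lt_min d0.
split=> s.
  by move=> ts; rewrite -ltrBlDl lt_min => /andP[sd _]; apply: hd; rewrite // -ltrBlDl.
move=> _; rewrite ltrBlDr -ltrBlDl lt_min => /andP[_ sd] st.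
by rewrite distrC; apply: hd' => //=; rewrite gtr0_norm ?subr_gt0.
Qed.

(** * The stochastic integral of the zero process *)

Section zero_integral.
Context {d} {T : measurableType d} {R : realType} {P : probability T R}.
Context {F : R -> set_system T}.
Hypothesis hF : filtration F.

Lemma filtration_setT (t : R) : 0 <= t -> F t setT.
Proof.
by move=> t0; have [/(_ t t0)[F0 FD _] _ _] := hF; rewrite -(setD0 setT); exact: FD.
Qed.

Lemma cst_stopping_time (a : R) : stopping_time F (cst a).
Proof.
move=> t t0; have [/(_ t t0)[F0 _ _] _ _] := hF.
have [at_|at_] := pselect (a <= t).
  rewrite (_ : [set w | _] = setT); first exact: filtration_setT.
  by apply/seteqP; split.
by rewrite (_ : [set w | _] = set0)//; apply/seteqP; split.
Qed.

Lemma cst_stopped_measurable (a b : R) (U : set R) :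
  stopped_sigma_algebra F (cst a) (cst b @^-1` U).
Proof.
have [Ub|Ub] := pselect (U b).
  rewrite (_ : _ @^-1` U = setT); last by apply/seteqP; split.
  by split=> // t t0; rewrite setTI; exact: cst_stopping_time.
rewrite (_ : _ @^-1` U = set0); last by apply/seteqP; split.
by split=> // t t0; rewrite set0I; have [/(_ t t0)[]] := hF.
Qed.

(** With size 0 both the process and its elementary integral are empty sums; the remaining fields
    are fillers. *)
Definition simple_predictable0 : simple_predictable F :=
  @SimplePredictable _ _ _ F 0 (fun _ => cst 0) (fun _ => cst 0)
    (fun _ => cst_stopping_time 0) (fun _ _ => lexx 0) (fun _ _ => lexx 0)
    (fun _ U _ => cst_stopped_measurable 0 0 U).

(** Right-continuity moves a time s < t where the bound is exceeded to a rational one. The endpoint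
    [t] is listed separately, as it cannot be moved to the right within ]0, t]. *)
Lemma measurable_sup_event (J : R -> T -> R) (t e : R) : cadlag J -> adapted F J ->
  measurable [set w | exists s : R, 0 < s <= t /\ e < `|J s w| ].
Proof.
move=> cJ aJ; have [_ Fm _] := hF.
have mJ s : 0 < s -> measurable [set w | e < `|J s w| ].
  move=> s0; apply: (Fm s (ltW s0)).
  apply: (aJ s (ltW s0) [set x | e < `|x| ]); apply: sub_sigma_algebra.
  apply: (@open_comp _ _ (fun x : R => `|x|) [set x | e < x]).
    by move=> x _; exact: norm_continuous.
  exact: open_gt.
have -> : [set w | exists s : R, 0 < s <= t /\ e < `|J s w| ] =
    (\bigcup_(q : rat) [set w | 0 < (ratr q : R) <= t /\ e < `|J (ratr q) w| ])
    `|` (if 0 < t then [set w | e < `|J t w| ] else set0).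
  apply/seteqP; split=> w /=.
    move=> [s [/andP[s0]]]; rewrite le_eqVlt => /orP[/eqP st|st] es.
      by right; rewrite -st s0.
    have [l cl] := cadlag_rcll w cJ (ltW s0).
    have e0 : 0 < (`|J s w| - e) / 2 by rewrite divr_gt0// subr_gt0.
    have [dl dl0 [cr _]] := cl _ e0.
    have [q] : exists q : rat, ratr q \in `]s, Num.min t (s + dl)[.
      by apply: rat_in_itvoo; rewrite lt_min st ltrDl.
    rewrite in_itv/= lt_min => /andP[sq /andP[qt qd]].
    left; exists q => //=; split; first by rewrite (lt_trans s0)//= ltW.
    have := cr _ (ltW sq) qd; have := ler_normB (J (ratr q) w) (J (ratr q) w - J s w).
    rewrite opprB addrCA subrr addr0; lra.
  move=> [[q _ [q0 eq]]|]; first by exists (ratr q).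
  by case: ifPn => // t0 et; exists t; rewrite t0 lexx.
apply: measurableU; last by case: ifPn => // /mJ.
apply: bigcupT_measurable_rat => q; have [qt|nq] := boolP (0 < (ratr q : R) <= t).
  rewrite (_ : [set w | _] = [set w | e < `|J (ratr q) w| ]).
    by apply: mJ; case/andP: qt.
  by apply/seteqP; split=> w /=; [case | split].
rewrite (_ : [set w | _] = set0)//; apply/seteqP; split=> w //= -[qt].
by case/negP: nq.
Qed.

(** The constant sequence of empty simple processes converges to [Y], so its integrals, all zero,
    converge to [J]. The probabilities in question do not depend on the index, hence they are
    zero. *)
Lemma stochastic_integral0 (M Y J : R -> T -> R) : (forall s w, Y s w = 0) ->
  stochastic_integral P F M Y J -> {ae P, forall w, forall t, 0 <= t -> J t w = 0}.
Proof.
move=> Y0 [cJ aJ].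
have ucpY : ucp_cvg P (fun n => sp_process simple_predictable0) Y.
  move=> t e t0 e0; rewrite (_ : (fun n : nat => _) = cst 0%E); first exact: cvg_cst.
  apply/funext => n /=; rewrite [X in P X](_ : _ = set0) ?measure0//.
  apply/seteqP; split=> w //= [s [_]].
  by rewrite /sp_process big_ord0 Y0 subrr normr0 ltNge ltW.
move=> /(_ _ ucpY) ucpJ.
pose B n := [set w | exists s : R, 0 < s <= n%:R /\ n.+1%:R^-1 < `|J s w| ].
have PB n : P (B n) = 0%E.
  have e0 : 0 < n.+1%:R^-1 :> R by rewrite invr_gt0.
  have := ucpJ n%:R _ (ler0n R n) e0.
  rewrite (_ : (fun k : nat => _) = cst (P (B n))).
    by move=> /cvg_lim <-//; rewrite lim_cst.
  apply/funext => k /=; congr (P _); apply/seteqP.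
  by split=> w /= [s hs]; exists s; move: hs; rewrite /sp_integral big_ord0 sub0r normrN.
have NB : P.-negligible (\bigcup_n B n).
  apply: negligible_bigcup => n; exists (B n).
  by split; [exact: measurable_sup_event | exact: PB |].
apply: negligibleS NB => w /=; apply: contra_notP => nB t t0.
have pos s : 0 < s -> J s w = 0.
  move=> s0; apply/normr0_eq0/eqP; rewrite eq_le normr_ge0 andbT leNgt.
  apply/negP => Js; apply: nB.
  have [N1 _ H1] := near_infty_natSinv_lt (PosNum Js).
  pose n := maxn N1 (Num.truncn s).+1.
  exists n => //; exists s; split.
    rewrite s0 (le_trans (ltW (truncnS_gt s)))// ler_nat; exact: leq_maxr.
  by apply: H1; rewrite /= leq_maxl.
move: t0; rewrite le_eqVlt => /orP[/eqP<-|]; last exact: pos.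
(* Time 0 is outside the reach of [ucp_cvg]; the value there follows by right-continuity. *)
have [l cl] := cadlag_rcll w cJ (lexx 0).
apply/normr0_eq0/eqP; rewrite eq_le normr_ge0 andbT.
apply/ler_addgt0Pl => e e0; rewrite addr0.
have [dl dl0 [cr _]] := cl e e0.
have dl2 : 0 < dl / 2 by rewrite divr_gt0.
have := cr (dl / 2) (ltW dl2); rewrite pos// sub0r normrN; apply.
by rewrite add0r ltr_pdivrMr// ltr_pMr// ltr1n.
Qed.
End zero_integral.

(** The [u n] are the components orthogonal to [V] of the points of a countable dense set. If [x] is
    orthogonal to all of them, its residual [y] is orthogonal to the dense set, hence zero. *)
Lemma separable_orthogonal_family {R : realType} {H : completeNormedModType R}
    {ip : {dot H for @idfun R}} (V : set H) : norm_from_dot ip ->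
    separable_space H -> fin_dim_subspace V ->
  exists u : nat -> H, (forall n w, V w -> ip w (u n) = 0) /\
    forall x, (forall n, ip (u n) x = 0) -> V x.
Proof.
move=> hip [D [cD dD]] hV.
have /choice[p hp] : forall x, exists v, V v /\ forall w, V w -> ip w (x - v) = 0.
  by move=> x; have [v Vv hv] := fin_dim_orthogonal_decomposition hip hV x; exists v.
have [f finj] := countable_injP _ cD.
(* Indices that code no point of [D] get the default 0, whose residual is orthogonal to [V] as
   well. *)
pose g n := xget 0 [set x | D x /\ f x = n].
exists (fun n => g n - p (g n)); split=> [n w|x xu]; first exact: (hp (g n)).2.
have gf y : D y -> g (f y) = y.
  move=> Dy; rewrite /g; case: xgetP => [z _ [Dz fz]|/(_ y)]; last by case.
  by apply: finj => //; exact: mem_set.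
pose y := x - p x.
have Dy v : D v -> ip v y = 0.
  move=> Dv; have := xu (f v); rewrite gf// => h.
  rewrite -[v](subrK (p v)) dotDl ((hp x).2 _ (hp v).1).
  by rewrite addr0 dotBr h sub0r (dotC _ (p x)) (hp v).2 ?oppr0//; exact: (hp x).1.
suff y0 : y = 0 by rewrite (subr0_eq y0); exact: (hp x).1.
apply/normr0_eq0/eqP; rewrite -sqrf_eq0 hip -normr_eq0 eq_le normr_ge0 andbT.
apply/ler_addgt0Pl => e e0; rewrite addr0.
have y1 : 0 < 1 + `|y| by rewrite ltr_wpDr.
have [|v [yv Dv]] := dD (ball y (e / (1 + `|y|))) _ (ball_open _ _).
  by exists y; apply: ballxx; rewrite divr_gt0.
rewrite -[ip y y]subr0 -(Dy v Dv) -dotBl (le_trans (norm_dot_le hip _ _))//.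
move: yv; rewrite -ball_normE /= => /ltW yv.
rewrite (le_trans (ler_wpM2r _ yv))// mulrAC ler_pdivrMr// ler_pM2l//.
by rewrite lerDr.
Qed.

Section weak_solution.
Context {R : realType} {d} {T : measurableType d} {P : probability T R}.
Context {F : R -> set_system T} {m : nat} {X : 'I_m -> R -> T -> R}.
Context {H : completeNormedModType R} {ip : {dot H for @idfun R}}.
Context {S : R -> H -> H} {DA : set H} {A alpha : H -> H}.
Context {sigma : 'I_m -> H -> H} {V : set H}.
Hypotheses (hF : filtration F) (hip : norm_from_dot ip).
Hypotheses (hS : c0_semigroup S) (hSpc : pseudo_contractive S).
Hypotheses (hA : generator S DA A) (hV : fin_dim_subspace V).
Hypotheses (hVA : operator_invariant DA A V) (hValpha : range alpha `<=` V).
Hypothesis hVsigma : forall k, range (sigma k) `<=` V.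
Variables (h : H) (r : R -> T -> H).
Hypothesis hr : weak_solution P F ip X DA A alpha sigma h r.

(* The weak formulation tested on \int_0^u S_s^* z ds, where neither alpha nor
   sigma contributes. *)
Lemma weak_solution_orthogonal z u : (forall w, V w -> ip w z = 0) -> 0 <= u ->
  {ae P, forall w, forall t, 0 <= t ->
    I (fun s => ip z (S s (r t w - h))) 0 u -
    (I (fun s => ip z (S u (r s w))) 0 t - I (fun s => ip z (S 0 (r s w))) 0 t)
    = 0}.
Proof.
move=> zV u0; have zV' w : V w -> ip w z = 0 by exact: zV.
have [xi [eta [adj hxi heta]]] := adjoint_graph_average hip hS hSpc hA z u0.
have xiV v : V v -> ip xi v = 0.
  move=> Vv; rewrite hxi.
  have -> : I (fun s => ip z (S s v)) 0 u = I (cst 0) 0 u; last first.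
    by rewrite Rintegral_cst// mul0r.
  apply: eq_Rintegral => s; rewrite inE/= in_itv/= => /andP[s0 _].
  exact: semigroup_dot_eq0 hVA _ _ _ _ _ _.
have [cr _ /(_ _ _ adj)[J [hJ hrJ]]] := hr.
have J0 : {ae P, forall w, forall k t, 0 <= t -> J k t w = 0}.
  have Jk k : {ae P, forall w, forall t, 0 <= t -> J k t w = 0}.
    apply: stochastic_integral0 (hJ k) => // s w.
    by apply: xiV; apply: hVsigma; exists (left_lim r s w).
  (* The finite index is recoded by natural numbers to apply countable intersection; the claim is
     vacuous for n >= m. *)
  have : {ae P, forall w, forall n (k : 'I_m), k = n :> nat ->
      forall t, 0 <= t -> J k t w = 0}.
    apply: ae_foralln => n; have [nm|mn] := ltnP n m.
      apply: filterS (Jk (Ordinal nm)) => w Jw k kn.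
      by rewrite (_ : k = Ordinal nm)//; exact: val_inj.
    by apply: aeW => w k kn; have := ltn_ord k; rewrite kn ltnNge mn.
  by apply: filterS => w Jw k; exact: (Jw k).
move: hrJ J0; apply: filterS2 => w hw Jw t t0.
have rw := cadlag_rcll w cr.
have [_ S0 _ _] := hS.
have := hw t t0; rewrite big1 ?addr0; last by move=> k _; exact: Jw.
rewrite -hxi dotBr => ->.
have -> : I (fun s => ip eta (r s w) + ip xi (alpha (r s w))) 0 t =
    I (fun s => ip z (S u (r s w)) - ip z (S 0 (r s w))) 0 t; last first.
  rewrite RintegralB//.
  - ring.
  - by apply: rcll_integrable => //; exact: rcll_dot.
  - by apply: rcll_integrable => //; exact: rcll_dot.
apply: eq_Rintegral => s _; rewrite heta xiV ?addr0 ?S0//.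
by apply: hValpha; exists (r s w).
Qed.

Hypothesis hsep : separable_space H.

Lemma weak_solution_semigroup :
  {ae P, forall w, forall t, 0 <= t -> V (r t w - S t h)}.
Proof.
have [u [uV uP]] := separable_orthogonal_family hip hsep hV.
have [cr _ _] := hr.
(* An enumeration of the rationals, with 0 for numbers that code none. *)
pose q k : rat := odflt 0%R (unpickle k).
have : {ae P, forall w, forall n k, 0 <= (ratr (q k) : R) -> forall t, 0 <= t ->
    I (fun s => ip (u n) (S s (r t w - h))) 0 (ratr (q k)) -
    (I (fun s => ip (u n) (S (ratr (q k)) (r s w))) 0 t -
     I (fun s => ip (u n) (S 0 (r s w))) 0 t) = 0}.
  apply: ae_foralln => n; apply: ae_foralln => k.
  have [q0|q0] := leP 0 (ratr (q k) : R).
    have := weak_solution_orthogonal (uV n) q0.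
    by apply: filterS => w hw _.
  by apply: aeW.
apply: filterS => w hw t t0; apply: uP => n.
apply: (transport_unique hip hS hSpc (c := r ^~ w)) => //.
  exact: cadlag_rcll.
move=> p s p0 s0; have := hw n (pickle p); rewrite /q pickleK /=; exact.
Qed.
End weak_solution.

Theorem corollary1p2 (R : realType)
    (d : measure_display) (T : measurableType d) (P : probability T R)
    (F : R -> set_system T)
    (hF : filtration F) (hFuc : usual_conditions P F)
    (m : nat) (X : 'I_m -> R -> T -> R)
    (hX : levy_process P F X)
    (hXmart : forall k, martingale P F (X k))
    (hXsq : forall k, square_integrable P (X k))
    (hXnt : forall k, nontrivial_process P (X k))
    (H : completeNormedModType R) (ip : {dot H for @idfun R})
    (hip : norm_from_dot ip) (hsep : separable_space H)
    (S : R -> H -> H) (hS : c0_semigroup S) (hSpc : pseudo_contractive S)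
    (DA : set H) (A : H -> H) (hA : generator S DA A)
    (alpha : H -> H) (halpha : lipschitz alpha)
    (sigma : 'I_m -> H -> H) (hsigma : lipschitz_pow sigma)
    (V : set H) (hV : fin_dim_subspace V)
    (hVA : operator_invariant DA A V)
    (hValpha : range alpha `<=` V)
    (hVsigma : forall k, range (sigma k) `<=` V) :
  affine_realization P F ip X DA A alpha sigma V.
Proof.
move=> h0; exists (fun t => [set S t h0 + v | v in V]); split.
- by exists (S ^~ h0); split=> //; exact: semigroup_continuous hS hSpc h0.
- move=> t0 _ t00 [v Vv <-] r hr.
  have := weak_solution_semigroup hF hip hS hSpc hA hV hVA hValpha hVsigma hr hsep.
  apply: filterS => w hw t t_ge0; have [_ _ Sadd _] := hS.
  (* The solution starts at S_{t0} h0 + v rather than on the curve itself; S_t v accounts for this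
     and stays in [V] by invariance. *)
  exists (r t w - S t (S t0 h0 + v) + S t v).
    apply: (fin_dimD hV); first exact: hw.
    exact: (semigroup_invariant hip hS hSpc hA hV hVA t_ge0 Vv).
  rewrite (semigroupD hS)// addrC [t0 + t]addrC Sadd// opprD addrA subrK.
  by rewrite subrK.
- by exists 0; [exact: fin_dim0 hV | have [_ S0 _ _] := hS; rewrite S0 addr0].
Qed.
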